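(* Let $(x^{(r)})_{r\ge 0}$ be generated by the cyclic block coordinate proximal gradient (BCPG) method, with inverse stepsizes $P_1,\dots,P_K$, applied to $$\min_{x_k\in X_k,\ k=1,\dots,K}\ f(x)=\tfrac12\Big\|\sum_{k=1}^K A_kx_k-b\Big\|^2+\sum_{k=1}^K h_k(x_k),$$ and let $\Delta^{(r)}=f(x^{(r)})-f^*$, where $f^*$ is the optimal value. Then for all $r\ge 0$: 1. If $P_k=L$ for all $k$, then $$\Delta^{(r+1)}\le 3\max\left\{\Delta^{(0)},\ 4\log^2(2NK)\,L\,R_0^2\right\}\frac{1}{r+1}.$$ 2. If $P_k=\lambda_{\max}(A_k^TA_k)=L_k$ for all $k$, then $$\Delta^{(r+1)}\le 3\max\left\{\Delta^{(0)},\ 2\log^2(2NK)\Big(L_{\max}+\frac{L^2}{L_{\min}}\Big)R_0^2\right\}\frac{1}{r+1}.$$ In particular, if in addition the problem is smooth and unconstrained, i.e. $h_k\equiv 0$ and $X_k=\mathbb{R}^N$ for all $k$, then $$\Delta^{(r+1)}\le 3\max\left\{L,\ 2\log^2(2NK)\Big(L_{\max}+\frac{L^2}{L_{\min}}\Big)\right\}\frac{R_0^2}{r+1}.$$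
   Context: Here $A_k\in\mathbb{R}^{M\times N}$, $b\in\mathbb{R}^M$, $x=(x_1,\dots,x_K)$ with blocks $x_k\in\mathbb{R}^N$, each $X_k\subseteq\mathbb{R}^N$ is a nonempty closed convex set, $X=X_1\times\cdots\times X_K$, and each $h_k:X_k\to\mathbb{R}$ is convex and lower semicontinuous (possibly nonsmooth). Write $g(x)=\frac12\|\sum_kA_kx_k-b\|^2$, $A=[A_1,\dots,A_K]$; $\nabla_k g$ is the partial gradient with respect to block $x_k$. $L=\lambda_{\max}(A^TA)$ is the Lipschitz constant of $\nabla g$, $L_k=\lambda_{\max}(A_k^TA_k)$, $L_{\max}=\max_kL_k$, $L_{\min}=\min_kL_k$. $\log$ is the natural logarithm and $\|\cdot\|$ the Euclidean norm. Cyclic BCPG: starting from $x^{(0)}\in X$, at iteration $r+1$, for $k=1,\dots,K$ successively, set $w_k^{(r+1)}=[x_1^{(r+1)},\dots,x_{k-1}^{(r+1)},x_k^{(r)},x_{k+1}^{(r)},\dots,x_K^{(r)}]$ and $$x_k^{(r+1)}=\arg\min_{x_k\in X_k}\ g(w_k^{(r+1)})+\langle\nabla_kg(w_k^{(r+1)}),x_k-x_k^{(r)}\rangle+\frac{P_k}{2}\|x_k-x_k^{(r)}\|^2+h_k(x_k),$$ where the inverse stepsizes satisfy $P_k>0$ and $P_k\ge L_k$ (so in part 2, $L_k>0$ for all $k$). $X^*$ is the set of optimal solutions, assumed nonempty, and $R_0=\max_{x\in X}\max_{x^*\in X^*}\{\|x-x^*\| : f(x)\le f(x^{(0)})\}$,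 assumed finite. *)

(* Defs.v *)
From mathcomp Require Import all_boot all_order all_algebra.
From mathcomp Require Import all_classical all_reals all_analysis.

Set Implicit Arguments.
Unset Strict Implicit.
Unset Printing Implicit Defensive.

Import Order.TTheory GRing.Theory Num.Theory.
Import numFieldNormedType.Exports.

Local Open Scope classical_set_scope.
Local Open Scope ring_scope.

Definition dotv (R : realType) (n : nat) (u v : 'cV[R]_n) : R :=
  (u^T *m v) 0 0.

(* The library norm on matrices is the max norm; this is the Euclidean one. *)
Definition enorm (R : realType) (n : nat) (v : 'cV[R]_n) : R :=
  Num.sqrt (dotv v v).

(* Meaningful when B has a real eigenvalue, e.g. B symmetric of positive size;
   it is only applied to Gram matrices. *)
Definition lambda_max (R : realType) (n : nat) (B : 'M[R]_n) : R :=
  sup [set a | eigenvalue B a].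

Section BCPG.
Context (R : realType) (M N K : nat).

(* x = (x_1, ..., x_K); the block index k of the paper is k - 1 : 'I_K. *)
Definition blocks := 'I_K -> 'cV[R]_N.

Implicit Types (A : 'I_K -> 'M[R]_(M, N)) (b : 'cV[R]_M).
Implicit Types (X : 'I_K -> set 'cV[R]_N) (h : 'I_K -> 'cV[R]_N -> R).
Implicit Types (P : 'I_K -> R) (x w : blocks).

Definition bdist x x' : R := enorm (\mxcol_(k < K) (x k - x' k)).

Definition smooth_part A b x : R :=
  2^-1 * enorm (\sum_(k < K) A k *m x k - b) ^+ 2.

Definition objective A b h x : R :=
  smooth_part A b x + \sum_(k < K) h k (x k).

Definition replace_block w (k : 'I_K) (y : 'cV[R]_N) : blocks :=
  fun j => if j == k then y else w j.

Definition partial_grad (g : blocks -> R) (k : 'I_K) w : 'cV[R]_N :=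
  \col_i ('D_(delta_mx i 0) (fun y => g (replace_block w k y)) (w k) : R).

Definition Lip A : R :=
  lambda_max ((\mxrow_(k < K) A k)^T *m (\mxrow_(k < K) A k)).

Definition Lblk A (k : 'I_K) : R := lambda_max ((A k)^T *m A k).

(* For K > 0 these are a maximum and a minimum, over a finite nonempty set. *)
Definition Lmax A : R := sup (range (Lblk A)).

Definition Lmin A : R := inf (range (Lblk A)).

Definition feasible X : set blocks := [set x | forall k, X k (x k)].

Definition is_argmin (T : Type) (D : set T) (phi : T -> R) (z : T) : Prop :=
  D z /\ forall y, D y -> phi z <= phi y.

(* Only the values of h k on X k matter; on `subspace (X k)` the points outside
   X k are isolated, so this is lower semicontinuity of h k restricted to X k. *)
Definition lsc_on (D : set 'cV[R]_N) (f : 'cV[R]_N -> R) : Prop :=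
  lower_semicontinuous (fun y : subspace D => (f y)%:E).

Definition optimal_set A b X h : set blocks :=
  [set x | is_argmin (feasible X) (objective A b h) x].

Definition optimal_value A b X h : R :=
  inf [set objective A b h x | x in feasible X].

Definition level_distances A b X h x0 : set R :=
  [set d | exists x x', [/\ feasible X x, optimal_set A b X h x',
     objective A b h x <= objective A b h x0 & d = bdist x x']].

Definition R0 A b X h x0 : R := sup (level_distances A b X h x0).

(* The point at which block k is updated: the blocks before k are new,
   the others are still old. *)
Definition partial_update (xnew xold : blocks) (k : 'I_K) : blocks :=
  fun j => if (j < k)%N then xnew j else xold j.

(* At w = partial_update xnew xold k, the prox center w k is xold k. *)
Definition prox_model A b h P w (k : 'I_K) (y : 'cV[R]_N) : R :=
  smooth_part A b w
  + dotv (partial_grad (smooth_part A b) k w) (y - w k)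
  + P k / 2 * enorm (y - w k) ^+ 2 + h k y.

Definition cyclic_bcpg A b X h P (x : nat -> blocks) : Prop :=
  feasible X (x 0%N) /\
  forall r k, is_argmin (X k)
    (prox_model A b h P (partial_update (x r.+1) (x r) k) k) (x r.+1 k).

End BCPG.

(* Main.v *)
Require Import Defs.
From mathcomp Require Import all_boot all_order all_algebra.
From mathcomp Require Import all_classical all_reals all_analysis.
From mathcomp Require Import ring lra.

Set Implicit Arguments.
Unset Strict Implicit.
Unset Printing Implicit Defensive.

Import Order.TTheory GRing.Theory Num.Theory.
Import numFieldNormedType.Exports.

Local Open Scope classical_set_scope.
Local Open Scope ring_scope.

(* Write d = x^(r+1) - x^r and e = x^(r+1) - x^*. The variational inequality of
   each proximal step gives the sufficient decrease
     f(x^r) - f(x^(r+1)) >= 1/2 sum_k P_k |d_k|^2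
   and, at y = x^*_k, the cost estimate
     f(x^(r+1)) - f^* <= sum_(k < j) <A_j d_j, A_k e_k>
                         - sum_k <(P_k - A_k^T A_k) d_k, e_k>.
   The first sum is the strict block-triangular part of A^T A. Halving the index
   interval recursively, and using that an off-diagonal corner block of a
   positive semidefinite form bounded by L has norm at most L / 2, its norm is
   at most L/2 * ceil(log2 K), which is below L ln(2NK). All
   products are split by Young's inequality with a free parameter t; optimizing
   over t yields (Delta^(r+1))^2 <= B (Delta^r - Delta^(r+1)), hence
   Delta^r <= 2 B / (r + 1). *)

(** * Euclidean inner product and largest eigenvalues of Gram matrices *)

Section Dot.
Context (R : realType).

Lemma dotvE n (u v : 'cV[R]_n) : dotv u v = \sum_i u i 0 * v i 0.
Proof. by rewrite /dotv mxE; apply: eq_bigr => i _; rewrite mxE. Qed.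

Lemma dotvC n (u v : 'cV[R]_n) : dotv u v = dotv v u.
Proof. by rewrite !dotvE; apply: eq_bigr => i _; rewrite mulrC. Qed.

Lemma dotvDr n (u v w : 'cV[R]_n) : dotv u (v + w) = dotv u v + dotv u w.
Proof. by rewrite /dotv mulmxDr mxE. Qed.

Lemma dotvDl n (u v w : 'cV[R]_n) : dotv (u + v) w = dotv u w + dotv v w.
Proof. by rewrite dotvC dotvDr !(dotvC w). Qed.

Lemma dotvZr n a (u v : 'cV[R]_n) : dotv u (a *: v) = a * dotv u v.
Proof. by rewrite /dotv -scalemxAr mxE. Qed.

Lemma dotvZl n a (u v : 'cV[R]_n) : dotv (a *: u) v = a * dotv u v.
Proof. by rewrite dotvC dotvZr dotvC. Qed.

Lemma dotvNr n (u v : 'cV[R]_n) : dotv u (- v) = - dotv u v.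
Proof. by rewrite /dotv mulmxN mxE. Qed.

Lemma dotvNl n (u v : 'cV[R]_n) : dotv (- u) v = - dotv u v.
Proof. by rewrite dotvC dotvNr dotvC. Qed.

Lemma dotv0r n (u : 'cV[R]_n) : dotv u 0 = 0.
Proof. by rewrite /dotv mulmx0 mxE. Qed.

Lemma dotv_sumr n I (r : seq I) (P : pred I) (F : I -> 'cV[R]_n) u :
  dotv u (\sum_(i <- r | P i) F i) = \sum_(i <- r | P i) dotv u (F i).
Proof.
by apply: (big_morph (dotv u)) => [v w|]; rewrite (dotvDr, dotv0r).
Qed.

Lemma dotv_suml n I (r : seq I) (P : pred I) (F : I -> 'cV[R]_n) u :
  dotv (\sum_(i <- r | P i) F i) u = \sum_(i <- r | P i) dotv (F i) u.
Proof. by rewrite dotvC dotv_sumr; apply: eq_bigr => i _; rewrite dotvC. Qed.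

Lemma dotv_ge0 n (u : 'cV[R]_n) : 0 <= dotv u u.
Proof. by rewrite dotvE sumr_ge0 // => i _; rewrite -expr2 sqr_ge0. Qed.

Lemma dotv_gt0 n (u : 'cV[R]_n) : (0 < dotv u u) = (u != 0).
Proof.
have [->|u0] := eqVneq u 0; first by rewrite dotv0r ltxx.
rewrite lt_def dotv_ge0 andbT; apply: contra u0.
rewrite dotvE psumr_eq0 => [/allP uu|i _]; last by rewrite -expr2 sqr_ge0.
apply/eqP/matrixP => i j; rewrite ord1 mxE.
by have := uu i (mem_index_enum i); rewrite -expr2 sqrf_eq0 => /eqP.
Qed.

Lemma dotv_mulmx m n (B : 'M[R]_(m, n)) u v :
  dotv u (B *m v) = dotv (B^T *m u) v.
Proof. by rewrite /dotv trmx_mul trmxK mulmxA. Qed.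

Lemma enorm_sqr n (u : 'cV[R]_n) : enorm u ^+ 2 = dotv u u.
Proof. by rewrite sqr_sqrtr // dotv_ge0. Qed.

Lemma enorm_ge0 n (u : 'cV[R]_n) : 0 <= enorm u.
Proof. exact: sqrtr_ge0. Qed.

(** Cauchy-Schwarz: the squared norm of |v|^2 u - <u, v> v is |v|^2 times the gap between the two
    sides. *)
Lemma dotv_sqr_le n (u v : 'cV[R]_n) : dotv u v ^+ 2 <= dotv u u * dotv v v.
Proof.
have [->|v0] := eqVneq v 0; first by rewrite !dotv0r mulr0 expr0n.
have vv : 0 < dotv v v by rewrite dotv_gt0.
have := dotv_ge0 (dotv v v *: u - dotv u v *: v).
rewrite !(dotvDl, dotvDr, dotvNl, dotvNr, dotvZl, dotvZr) (dotvC v u).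
move=> w_ge0; rewrite -subr_ge0 -(pmulr_rge0 _ vv).
by apply: le_trans w_ge0 _; rewrite le_eqVlt; apply/orP; left; apply/eqP; ring.
Qed.

Lemma mulmx_bounded m n (B : 'M[R]_(m, n)) :
  exists2 C, 0 < C & forall v, dotv (B *m v) (B *m v) <= C * dotv v v.
Proof.
pose C := \sum_i dotv (row i B)^T (row i B)^T.
have C_ge0 : 0 <= C by apply: sumr_ge0 => i _; exact: dotv_ge0.
exists (C + 1) => [|v]; first exact: ltr_wpDl.
rewrite dotvE; apply: (@le_trans _ _ (C * dotv v v)); last first.
  by rewrite ler_wpM2r ?dotv_ge0 // lerDl.
rewrite mulr_suml; apply: ler_sum => i _.
have -> : (B *m v) i 0 = dotv (row i B)^T v.
  by rewrite /dotv trmxK -row_mul [RHS]mxE.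
by rewrite -expr2 dotv_sqr_le.
Qed.

Lemma gram_eigenvalue m n (B : 'M[R]_(m, n)) a :
  eigenvalue (B^T *m B) a ->
  exists2 v, v != 0 & dotv (B *m v) (B *m v) = a * dotv v v.
Proof.
case/eigenvalueP => v vB v0; exists v^T; first by rewrite trmx_eq0.
rewrite dotv_mulmx -dotvZl; congr dotv.
have -> : a *: v^T = (v *m (B^T *m B))^T by rewrite vB linearZ.
by rewrite !trmx_mul trmxK mulmxA.
Qed.

(* With mu the supremum of the Rayleigh quotient, mu - B^T B is positive
   semidefinite. If it were invertible it would be coercive, and mu could be
   lowered. *)
Lemma gram_top_eigenvalue m n (B : 'M[R]_(m, n)) : (0 < n)%N ->
  exists2 mu, eigenvalue (B^T *m B) mu &
    forall v, dotv (B *m v) (B *m v) <= mu * dotv v v.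
Proof.
case: n B => // n B _.
have [C C_gt0 BC] := mulmx_bounded B.
pose E := [set a | exists2 v : 'cV[R]_n.+1, v != 0 &
  a = dotv (B *m v) (B *m v) / dotv v v].
have E0 : E !=set0.
  pose v : 'cV[R]_n.+1 := const_mx 1.
  exists (dotv (B *m v) (B *m v) / dotv v v), v => //.
  by apply/eqP => /matrixP/(_ 0 0)/eqP; rewrite !mxE oner_eq0.
have Eub : has_ubound E.
  by exists C => _ [v v0 ->]; rewrite ler_pdivrMr ?dotv_gt0.
pose mu := sup E.
have Bmu v : dotv (B *m v) (B *m v) <= mu * dotv v v.
  have [->|v0] := eqVneq v 0; first by rewrite mulmx0 !dotv0r mulr0.
  rewrite -ler_pdivrMr ?dotv_gt0 //; apply: ub_le_sup => //.
  by exists v.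
have mu_ge0 : 0 <= mu.
  case: E0 => _ [v v0 _]; have := le_trans (dotv_ge0 _) (Bmu v).
  by rewrite pmulr_lge0 // dotv_gt0.
exists mu => //; rewrite /eigenvalue /eigenspace kermx_eq0 row_free_unit.
set T := (_ - _); apply/negP => T_unit.
(* [T] is B^T B - mu I, so [S] is the positive semidefinite matrix whose quadratic form is [q]. *)
pose S := - T.
have SE v : S *m v = mu *: v - B^T *m (B *m v).
  by rewrite /S /T opprB mulmxBl mul_scalar_mx mulmxA.
pose q v := mu * dotv v v - dotv (B *m v) (B *m v).
have q_ge0 v : 0 <= q v by rewrite subr_ge0.
(* Evaluate q >= 0 at v - t S v with t = 1 / (mu + 1), using q(S v) <= (mu + 1) |S v|^2. The added 1
   avoids dividing by zero when mu = 0. *)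
have Sq v : dotv (S *m v) (S *m v) <= (mu + 1) * q v.
  have mu1 : 0 < mu + 1 by lra.
  pose t := (mu + 1)^-1.
  have t_gt0 : 0 < t by rewrite invr_gt0.
  have qSv : q (S *m v) <= (mu + 1) * dotv (S *m v) (S *m v).
    have := dotv_ge0 (B *m (S *m v)); have := dotv_ge0 (S *m v).
    rewrite /q; lra.
  have vSv : dotv v (S *m v) = q v.
    by rewrite SE dotvDr dotvNr dotvZr (dotv_mulmx _ v) trmxK.
  have := q_ge0 (v - t *: (S *m v)).
  have -> : q (v - t *: (S *m v)) =
      q v - 2 * t * dotv (S *m v) (S *m v) + t ^+ 2 * q (S *m v).
    have -> : dotv (S *m v) (S *m v) =
        mu * dotv v (S *m v) - dotv (B *m v) (B *m (S *m v)).
      rewrite {1}SE dotvDl dotvNl dotvZl; congr (_ - _).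
      by rewrite dotvC (dotv_mulmx _ (S *m v)) trmxK dotvC.
    rewrite /q mulmxBr -scalemxAr.
    rewrite !(dotvDl, dotvDr, dotvNl, dotvNr, dotvZl, dotvZr).
    rewrite (dotvC (S *m v) v) (dotvC (B *m (S *m v)) (B *m v)).
    by ring.
  set s := dotv _ _; rewrite -/s in qSv => h.
  have : 0 <= q v - 2 * t * s + t ^+ 2 * ((mu + 1) * s).
    apply: le_trans h _; rewrite lerD2l ler_wpM2l ?sqr_ge0 //.
  have -> : t ^+ 2 * ((mu + 1) * s) = t * s.
    by rewrite /t; field; lra.
  move=> h'; have : t * s <= q v by lra.
  by rewrite /t mulrC ler_pdivrMr // mulrC.
have S_unit : S \in unitmx by rewrite -[_ \in _]/(S \is a GRing.unit) unitrN.
have [C' C'_gt0 SC] := mulmx_bounded (invmx S).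
have D_gt0 : 0 < C' * (mu + 1) by rewrite mulr_gt0 // ltr_wpDl.
have := D_gt0; rewrite -invr_gt0 => iD_gt0.
(* Coercivity reads |v|^2 <= C' |S v|^2 <= C' (mu + 1) q(v), which lowers every Rayleigh quotient
   below mu by a fixed amount. *)
suff : mu <= mu - (C' * (mu + 1))^-1 by lra.
apply: ge_sup => // _ [v v0 ->].
rewrite ler_pdivrMr ?dotv_gt0 // mulrBl lerBrDr -lerBrDl.
rewrite -/(q v) ler_pdivrMl // -mulrA.
have {1 2}-> : v = invmx S *m (S *m v) by rewrite mulKmx.
by apply: le_trans (SC _) _; rewrite ler_pM2l.
Qed.

Lemma gram_lambda_max_le m n (B : 'M[R]_(m, n)) c : (0 < n)%N ->
  (forall v, dotv (B *m v) (B *m v) <= c * dotv v v) ->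
  lambda_max (B^T *m B) <= c.
Proof.
move=> n_gt0 Bc; have [mu mu_eig _] := gram_top_eigenvalue B n_gt0.
apply: ge_sup => [|a /gram_eigenvalue[v v0]]; first by exists mu.
by move=> va; have := Bc v; rewrite va ler_pM2r // dotv_gt0.
Qed.

(** [lambda_max] is only a supremum. Every eigenvalue is a Rayleigh quotient, hence at most the mu
    of [gram_top_eigenvalue]; so the supremum is finite and dominates mu. *)
Lemma gram_le_lambda_max m n (B : 'M[R]_(m, n)) v : (0 < n)%N ->
  dotv (B *m v) (B *m v) <= lambda_max (B^T *m B) * dotv v v.
Proof.
move=> n_gt0; have [mu mu_eig Bmu] := gram_top_eigenvalue B n_gt0.
apply: le_trans (Bmu v) _; rewrite ler_wpM2r ?dotv_ge0 //.
apply: ub_le_sup => //; exists mu => a /gram_eigenvalue[w w0 wa].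
by have := Bmu w; rewrite wa ler_pM2r // dotv_gt0.
Qed.

Lemma gram_lambda_max_ge0 m n (B : 'M[R]_(m, n)) : (0 < n)%N ->
  0 <= lambda_max (B^T *m B).
Proof.
case: n B => // n B _.
have := le_trans (dotv_ge0 _) (@gram_le_lambda_max _ _ B (const_mx 1) isT).
rewrite pmulr_lge0 // dotv_gt0; apply/eqP => /matrixP/(_ 0 0)/eqP.
by rewrite !mxE oner_eq0.
Qed.

End Dot.

(* Halving the interval [a, b) costs one off-diagonal corner block; as the Gram
   form is positive semidefinite, such a block has norm at most L / 2. *)
Lemma triangular_truncation (R : realType) n (L : R) (D E : nat -> 'cV[R]_n)
    (d e : nat -> R) (K : nat) :
  0 <= L -> (forall k, 0 <= d k) -> (forall k, 0 <= e k) ->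
  (forall a p b, (a <= p)%N -> (p <= b)%N -> (b <= K)%N ->
     let s := \sum_(a <= k < p) E k + \sum_(p <= k < b) D k in
     dotv s s <= L * (\sum_(a <= k < p) e k + \sum_(p <= k < b) d k)) ->
  forall m a b, (a <= b)%N -> (b <= K)%N -> (b <= a + 2 ^ m)%N ->
  4 * (\sum_(a <= j < b) \sum_(a <= k < j) dotv (D j) (E k))
    <= m%:R * L * \sum_(a <= k < b) (d k + e k).
Proof.
move=> L_ge0 d_ge0 e_ge0 DE_le; elim=> [|m IHm] a b ab bK b_le.
  (* An interval with at most 2^0 indices contains no pair k < j. *)
  rewrite mul0r mul0r big_nat big1 ?mulr0 // => j /andP[aj jb].
  by rewrite big_geq // -ltnS (leq_trans jb) // (leq_trans b_le) // addn1.
have [b_le'|/ltnW lt_b] := leqP b (a + 2 ^ m).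
  apply: le_trans (IHm a b ab bK b_le') _.
  rewrite ler_wpM2r ?sumr_ge0 // => [k _|]; first by rewrite addr_ge0.
  by rewrite ler_wpM2r // ler_nat.
set p := (a + 2 ^ m)%N in lt_b *.
have ap : (a <= p)%N by rewrite leq_addr.
have lo := IHm a p ap (leq_trans lt_b bK) (leqnn _).
have hi := IHm p b lt_b bK.
rewrite /p -addnA addnn -mul2n -expnS -/p in hi; have {}hi := hi b_le.
have := DE_le a p b ap lt_b bK => /=.
set SE := \sum_(a <= k < p) E k; set SD := \sum_(p <= k < b) D k => corner.
(* Polarization: |SE + SD|^2 - 4 <SD, SE> = |SE - SD|^2 >= 0. *)
have cornerE : 4 * dotv SD SE <=
    L * (\sum_(a <= k < p) e k + \sum_(p <= k < b) d k).
  apply: le_trans corner; rewrite -subr_ge0.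
  rewrite (_ : _ - _ = dotv (SE - SD) (SE - SD)) ?dotv_ge0 //.
  rewrite !(dotvDl, dotvDr, dotvNl, dotvNr) (dotvC SE SD).
  by ring.
rewrite (big_cat_nat ap lt_b) /=.
have -> : \sum_(p <= j < b) \sum_(a <= k < j) dotv (D j) (E k) =
    dotv SD SE + \sum_(p <= j < b) \sum_(p <= k < j) dotv (D j) (E k).
  rewrite dotv_suml -big_split /= !big_nat; apply: eq_bigr => j /andP[pj _].
  by rewrite (big_cat_nat ap pj) /= -dotv_sumr.
rewrite [X in _ <= _ * X](big_cat_nat ap lt_b) /=.
move: lo hi cornerE; rewrite !big_split /=.
(* The corner uses only [e] on the left half and [d] on the right half; the two missing sums are
   nonnegative and complete the total over [a, b). *)
have : 0 <= \sum_(a <= k < p) d k by apply: sumr_ge0.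
have : 0 <= \sum_(p <= k < b) e k by apply: sumr_ge0.
set d1 := \sum_(a <= k < p) d k; set e1 := \sum_(a <= k < p) e k.
set d2 := \sum_(p <= k < b) d k; set e2 := \sum_(p <= k < b) e k.
set T1 := \sum_(a <= j < p) _; set T2 := \sum_(p <= j < b) _.
move=> e2_ge0 d1_ge0.
have := mulr_ge0 L_ge0 e2_ge0; have := mulr_ge0 L_ge0 d1_ge0.
rewrite -(natr1 m); lra.
Qed.

(** * Bounds on logarithms and scalar recursions *)

(** Since (14/15)^10 >= 1/2 and ln(14/15) <= -1/15, one gets ln 2 >= -10 ln(14/15) >= 10/15. *)
Lemma ln2_ge (R : realType) : 2 / 3 <= ln 2 :> R.
Proof.
have q_gt0 : 0 < 14 / 15 :> R by lra.
have : 10 * ln (14 / 15) <= - (2 / 3) :> R.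
  have := @le_ln1Dx R (- (1 / 15)); rewrite (_ : 1 + _ = 14 / 15); last by field.
  by move=> /(_ ltac:(lra)) ?; lra.
have : - ln 2 <= 10 * ln (14 / 15) :> R.
  rewrite -lnV ?posrE // mulr_natl -lnXn // ler_ln ?posrE ?invr_gt0 ?exprn_gt0 //.
  by lra.
by lra.
Qed.

(* With c = m / 2 the norm of the strict triangular part, the cost estimate has
   the constant 2 (c + 1) (c p + q). The right-hand side is 3/2 of the constant
   2 ln(2n)^2 (p + q) of the theorem: quadratic_descent_rate loses only a factor
   2 where the theorem allows 3. For n = 1, where c = 0, this slack is needed. *)
Lemma ln_double_lower (R : realType) n : (0 < n)%N ->
  exists2 m, (n <= 2 ^ m)%N & forall p q : R, 0 <= q -> q <= p ->
    2 * (m%:R / 2 + 1) * (m%:R / 2 * p + q)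
      <= 3 * ln (2 * n)%:R ^+ 2 * (p + q).
Proof.
move=> n_gt0; exists (up_log 2 n); first exact: up_logP.
move=> p q q_ge0 qp; have l_ge := ln2_ge R.
have lnX (x k : nat) : (2 ^ k <= x)%N -> k%:R * (2 / 3) <= ln x%:R :> R.
  move=> kx; apply: (@le_trans _ _ (ln (2 ^+ k))).
    by rewrite lnXn // -[leRHS]mulr_natl ler_wpM2l.
  rewrite -natrX ler_ln ?posrE ?ltr0n ?expn_gt0 ?ler_nat //.
  by rewrite (leq_trans _ kx) // expn_gt0.
have [n1|n_gt1] := leqP n 1.
  have -> : n = 1%N by apply/eqP; rewrite eqn_leq n1.
  rewrite up_log1 muln1; have : (2/3) ^+ 2 <= ln 2 ^+ 2 :> R.
    by rewrite lerXn2r ?nnegrE //; lra.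
  move/(ler_wpM2r (addr_ge0 (le_trans q_ge0 qp) q_ge0)); lra.
(* Here 2n = 2^(m+1) with m = 1. The bound 2^m <= 2n used for larger n would be too weak for m =
   1. *)
have [->|n2] := eqVneq n 2.
  have -> : up_log 2 2 = 1%N by [].
  have := lnX 4 2%N isT; rewrite -[(2 * 2)%N]/4%N => l4.
  have : (4/3) ^+ 2 <= ln 4 ^+ 2 :> R.
    by rewrite lerXn2r ?nnegrE //; lra.
  move/(ler_wpM2r (addr_ge0 (le_trans q_ge0 qp) q_ge0)); lra.
have n_gt2 : (2 < n)%N by rewrite ltn_neqAle eq_sym n2.
set m := up_log 2 n.
have m_ge2 : (1 < m)%N.
  by rewrite -(@ltn_exp2l 2) //; apply: leq_trans n_gt2 (up_logP _ _).
(* Minimality of [m] gives 2^(m-1) < n, hence ln(2n) >= 2m/3. *)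
have mn : (2 ^ m <= 2 * n)%N.
  by rewrite -(prednK (ltnW m_ge2)) expnS leq_mul2l /= ltnW // up_log_gtn.
have := lnX _ _ mn; set l2 := ln _ => l2_ge.
have mR : 2 <= m%:R :> R by rewrite (ler_nat _ 2).
move: (m%:R : R) mR l2_ge => x x_ge l2_ge.
have : (x * (2 / 3)) ^+ 2 <= l2 ^+ 2 by rewrite lerXn2r ?nnegrE //; nra.
set L2 := l2 ^+ 2 => L2_ge.
have : (x * (2 / 3)) ^+ 2 * (p + q) <= L2 * (p + q) by rewrite ler_wpM2r //; lra.
have : x * q <= x * p by rewrite ler_wpM2l //; lra.
have : q * 2 <= q * x by rewrite ler_wpM2l.
have : 2 * (x * q) <= x * (x * q) by rewrite ler_wpM2r //; nra.
have : 2 * (x * p) <= x * (x * p) by rewrite ler_wpM2r //; nra.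
nra.
Qed.

(** The choice t = q / a makes the second term equal to a and avoids square roots. For q = 0 the
    choice t = a / (p + 1) forces a = 0. *)
Lemma sqr_le_of_young (R : realType) (a p q : R) : 0 <= a -> 0 <= p -> 0 <= q ->
  (forall t, 0 < t -> 2 * a <= p * t + q / t) -> a ^+ 2 <= p * q.
Proof.
move=> a_ge0 p_ge0 q_ge0 young.
have [->|a0] := eqVneq a 0; first by rewrite expr0n mulr_ge0.
have a_gt0 : 0 < a by rewrite lt_def a0.
have [q0|q0] := eqVneq q 0.
  have p1_gt0 : 0 < p + 1 by lra.
  have := young (a / (p + 1)) (divr_gt0 a_gt0 p1_gt0).
  rewrite q0 mul0r addr0 mulrA ler_pdivlMr //; nra.
have q_gt0 : 0 < q by rewrite lt_def q0.
have := young (q / a) (divr_gt0 q_gt0 a_gt0).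
have -> : p * (q / a) + q / (q / a) = (p * q + a ^+ 2) / a.
  by field; rewrite ?q0 ?a0.
rewrite ler_pdivlMr // expr2; lra.
Qed.

(** Induction with s = r + 1, x = a_r, y = a_(r+1). If y (s + 1) > 2B, then s y^2 <= B (2B - s y),
    multiplied by (s + 1)^2, gives 4 B^2 s < 2 B^2 (s + 1), which is impossible for s >= 1. *)
Lemma quadratic_descent_rate (R : realType) (a : nat -> R) (B : R) :
  (forall r, 0 <= a r) -> a 0%N <= B ->
  (forall r, a r.+1 ^+ 2 <= B * (a r - a r.+1)) ->
  forall r, a r <= 2 * B / r.+1%:R.
Proof.
move=> a_ge0 a0B aB; have B_ge0 : 0 <= B by apply: le_trans a0B.
elim=> [|r IHr]; first by rewrite divr1; lra.
rewrite leNgt; apply/negP; move: IHr (aB r) (a_ge0 r.+1).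
set y := a r.+1; set x := a r.
have r_ge1 : 1 <= r.+1%:R :> R by rewrite ler1n.
rewrite ler_pdivlMr ?ltr0n // ltr_pdivrMr ?ltr0n // -(natr1 r.+1).
move: (r.+1%:R) r_ge1 => s s_ge1 xs yB y_ge0 ys.
have s_gt0 : 0 < s by lra.
have By_ge0 : 0 <= B * s * (s + 1) by rewrite !mulr_ge0 //; lra.
have h1 : y ^+ 2 * s <= B * (2 * B - y * s).
  by have : B * (x * s) <= B * (2 * B) by [rewrite ler_wpM2l]; nra.
have h2 := ler_wpM2r (sqr_ge0 (s + 1)) h1.
have h3 : (2 * B) ^+ 2 < (y * (s + 1)) ^+ 2.
  by rewrite ltrXn2r ?nnegrE //; nra.
have h4 : (2 * B) ^+ 2 * s < (y * (s + 1)) ^+ 2 * s by rewrite ltr_pM2r.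
have h5 := ler_wpM2l By_ge0 (ltW ys).
have h6 : 0 <= B ^+ 2 * (s - 1) by rewrite mulr_ge0 ?sqr_ge0 ?subr_ge0.
lra.
Qed.

(** * Proximal steps, block quadratic forms and partial gradients *)

(** Comparing z with t y + (1 - t) z and dividing by t gives 0 <= Q + t C for t in (0, 1], where Q
    is the gap of the claimed inequality. *)
Lemma variational_inequality (R : realType) n (X : set 'cV[R]_n)
    (h : 'cV[R]_n -> R) (c p : R) (g w z y : 'cV[R]_n) :
  convex_set X -> convex_function X h -> 0 <= p ->
  is_argmin X (fun y => c + dotv g (y - w) + p / 2 * enorm (y - w) ^+ 2 + h y) z ->
  X y ->
  h z - h y <= dotv g (y - z) + p * dotv (z - w) (y - z).
Proof.
move=> X_convex h_convex p_ge0 [Xz z_min] Xy.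
set C := p / 2 * dotv (y - z) (y - z).
have C_ge0 : 0 <= C by rewrite mulr_ge0 ?dotv_ge0 //; lra.
rewrite -subr_ge0; set Q := _ - _.
have Q_ge t : 0 < t -> t <= 1 -> 0 <= Q + t * C.
  move=> t_gt0 t_le1.
  pose T : {i01 R} := Itv01 (ltW t_gt0) t_le1.
  pose yt : 'cV[R]_n := t *: y + (1 - t) *: z.
  have Xyt : X yt by have := X_convex y z T; rewrite !inE; exact.
  have hyt : h yt <= t * h y + (1 - t) * h z.
    by have := h_convex T y z; rewrite !inE; exact.
  have ytz : yt - w = (z - w) + t *: (y - z).
    rewrite /yt scalerBr scalerBl scale1r.
    by apply/matrixP => i j; rewrite !mxE; ring.
  have := z_min _ Xyt; rewrite ytz !enorm_sqr.
  rewrite !(dotvDl _ (t *: _)) !(dotvDr _ _ (t *: _)) !dotvZl !dotvZr.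
  rewrite (dotvC (y - z) (z - w)) => z_le.
  rewrite -(pmulr_rge0 _ t_gt0) /Q /C.
  move: z_le hyt; move: (dotv _ _) (dotv _ _) (dotv _ _) (dotv _ _) (dotv _ _).
  by move=> ? ? ? ? ?; lra.
rewrite leNgt; apply/negP => Q_lt0.
have CQ : 0 < 2 * C - Q by lra.
(* An explicit small t replaces the limit t -> 0: here Q + t C = Q (C - Q) / (2C - Q) < 0. *)
have := Q_ge (- Q / (2 * C - Q)).
rewrite divr_gt0 ?oppr_gt0 // ler_pdivrMr // mul1r => /(_ isT).
have -> : - Q <= 2 * C - Q by lra.
move=> /(_ isT); rewrite mulrAC -[Q in Q + _](mulfK (lt0r_neq0 CQ)) -mulrDl.
by rewrite pmulr_lge0 ?invr_gt0 //; nra.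
Qed.

Section BlockForms.
Context (R : realType) (M N K : nat).
Implicit Types (A : 'I_K -> 'M[R]_(M, N)) (b : 'cV[R]_M).
Implicit Types (v w x : blocks R N K).

Lemma dotv_mxcol (u v : blocks R N K) :
  dotv (\mxcol_k u k) (\mxcol_k v k) = \sum_k dotv (u k) (v k).
Proof. by rewrite /dotv tr_mxcol mul_mxrow_mxcol summxE. Qed.

Lemma bdist_sqr x x' : bdist x x' ^+ 2 = \sum_k dotv (x k - x' k) (x k - x' k).
Proof. by rewrite /bdist enorm_sqr dotv_mxcol. Qed.

Lemma Lip_form_le A v : (0 < N)%N -> (0 < K)%N ->
  dotv (\sum_k A k *m v k) (\sum_k A k *m v k)
    <= Lip A * \sum_k dotv (v k) (v k).
Proof.
move=> N_gt0 K_gt0; rewrite -mul_mxrow_mxcol -dotv_mxcol.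
apply: gram_le_lambda_max.
by rewrite sum_nat_const card_ord muln_gt0 K_gt0.
Qed.

(** Test the full form on vectors supported in block k. *)
Lemma Lblk_le_Lip A k : (0 < N)%N -> (0 < K)%N -> Lblk A k <= Lip A.
Proof.
move=> N_gt0 K_gt0; apply: gram_lambda_max_le => // v.
pose V : blocks R N K := fun j => if j == k then v else 0.
have := Lip_form_le A V N_gt0 K_gt0.
rewrite (bigD1 k) //= [X in _ * X](bigD1 k) //= /V eqxx.
rewrite !big1 ?addr0 // => j /negPf ->; by rewrite ?mulmx0 ?dotv0r.
Qed.

Definition residual A b x : 'cV[R]_M := \sum_k A k *m x k - b.

Lemma smooth_partE A b x :
  smooth_part A b x = 2^-1 * dotv (residual A b x) (residual A b x).
Proof. by rewrite /smooth_part enorm_sqr. Qed.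

Lemma residual_replace A b w k y :
  residual A b (replace_block w k y) = residual A b w + A k *m (y - w k).
Proof.
rewrite /residual (bigD1 k) //= [in RHS](bigD1 k) //= /replace_block eqxx.
rewrite mulmxBr; under eq_bigr => j /negPf -> do [].
by apply/matrixP => i j; rewrite !mxE; ring.
Qed.

Lemma partial_gradE A b k w :
  partial_grad (smooth_part A b) k w = (A k)^T *m residual A b w.
Proof.
apply/matrixP => i j; rewrite ord1 mxE {j}.
set e := delta_mx i 0.
pose q := 2^-1 * dotv (A k *m e) (A k *m e).
have -> : ((A k)^T *m residual A b w) i 0 = dotv (residual A b w) (A k *m e).
  rewrite dotv_mulmx dotvE (bigD1 i) //= big1 ?addr0 => [|j ji].
    by rewrite [e i 0]mxE !eqxx mulr1.
  by rewrite [e j 0]mxE (negPf ji) mulr0.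
apply/cvg_lim => //.
(* The smooth part is quadratic, so its difference quotient along [e] is exactly affine in t. *)
have lin : (dotv (residual A b w) (A k *m e) + t * q) @[t --> (0 : R)^'] -->
    dotv (residual A b w) (A k *m e).
  rewrite -[X in _ --> X]addr0 -[X in _ --> _ + X](mul0r q).
  apply: cvgD; first exact: cvg_cst.
  by apply: cvgMl; apply: cvg_within_filter; exact: cvg_id.
apply: cvg_trans lin; apply: near_eq_cvg.
near=> t; have t0 : t != 0 by near: t; exact: nbhs_dnbhs_neq.
rewrite /= !smooth_partE !residual_replace addrK subrr mulmx0 addr0.
move: (residual A b w) => rho.
rewrite -scalemxAr !(dotvDl, dotvDr, dotvZl, dotvZr) (dotvC _ rho) /q.
by rewrite /GRing.scale /=; field.
Unshelve. all: by end_near.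
Qed.

End BlockForms.

(** * Descent and cost estimates for one cyclic pass *)

(** Add the u_k one at a time. With s a residual, the partial sums are the residuals at which the
    successive block gradients are taken. *)
Lemma half_sqr_telescope (R : realType) n K (s : 'cV[R]_n) (u : 'I_K -> 'cV[R]_n) :
  2^-1 * dotv (s + \sum_k u k) (s + \sum_k u k) - 2^-1 * dotv s s =
  \sum_(k < K) (dotv (s + \sum_(j < K | (j < k)%N) u j) (u k)
                + 2^-1 * dotv (u k) (u k)).
Proof.
pose S m := s + \sum_(j < K | (j < m)%N) u j.
pose G m := 2^-1 * dotv (S m) (S m).
have SS (k : 'I_K) : S k.+1 = S k + u k.
  rewrite /S -addrA (bigD1 k) //= [u k + _]addrC; congr (_ + (_ + _)).
  by apply: eq_bigl => j; rewrite ltnS ltn_neqAle -val_eqE andbC.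
rewrite (_ : s + _ = S K); last first.
  by rewrite /S; congr (_ + _); apply: eq_bigl => j; rewrite ltn_ord.
rewrite {1 2}(_ : s = S 0%N); last by rewrite /S big_pred0 ?addr0.
rewrite -/(G K) -/(G 0%N) -(telescope_sumr G (leq0n K)) big_mkord.
apply: eq_bigr => k _; rewrite /G SS -/(S k).
by rewrite !(dotvDl (S k), dotvDr _ (S k)) (dotvC (u k) (S k)); field.
Qed.

Section CyclicPass.
Context (R : realType) (M N K : nat).
Context (A : 'I_K -> 'M[R]_(M, N)) (b : 'cV[R]_M).
Context (X : 'I_K -> set 'cV[R]_N) (h : 'I_K -> 'cV[R]_N -> R) (P : 'I_K -> R).

Lemma residual_partial_update (xn xo : blocks R N K) k :
  residual A b (partial_update xn xo k)
  = residual A b xo + \sum_(j < K | (j < k)%N) A j *m (xn j - xo j).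
Proof.
rewrite /residual [X in _ = _ + X]big_mkcond addrAC -big_split; congr (_ - _).
apply: eq_bigr => j _; rewrite /partial_update; case: ifP => _ /=.
  by rewrite -mulmxDr addrC subrK.
by rewrite addr0.
Qed.

Lemma residualB (xn xo : blocks R N K) :
  residual A b xn = residual A b xo + \sum_j A j *m (xn j - xo j).
Proof.
rewrite /residual addrAC -big_split; congr (_ - _).
by apply: eq_bigr => j _ /=; rewrite -mulmxDr addrC subrK.
Qed.

(** The optimality conditions of the K proximal steps of a pass, with A_k^T moved across the inner
    product. The estimates below use the pass only through them. *)
Definition pass_vi (xn xo : blocks R N K) := forall k y, X k y ->
  h k (xn k) - h k y <=
    dotv (residual A b (partial_update xn xo k)) (A k *m (y - xn k))
    + P k * dotv (xn k - xo k) (y - xn k).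

Lemma cyclic_bcpg_pass_vi (x : nat -> blocks R N K) r :
  (forall k, convex_set (X k)) -> (forall k, convex_function (X k) (h k)) ->
  (forall k, 0 <= P k) -> cyclic_bcpg A b X h P x -> pass_vi (x r.+1) (x r).
Proof.
move=> X_convex h_convex P_ge0 [_ /(_ r)x_min] k y Xy.
have wk : partial_update (x r.+1) (x r) k k = x r k.
  by rewrite /partial_update ltnn.
rewrite [X in _ <= X + _]dotv_mulmx -partial_gradE -wk.
exact: variational_inequality (x_min k) Xy.
Qed.

Hypothesis N_gt0 : (0 < N)%N.
Hypothesis P_ge : forall k, Lblk A k <= P k.

Lemma block_form_le k v : dotv (A k *m v) (A k *m v) <= P k * dotv v v.
Proof.
apply: le_trans (gram_le_lambda_max _ _ N_gt0) _.
by rewrite ler_wpM2r ?dotv_ge0 // P_ge.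
Qed.

(** Take y = xo_k. Each step gains P_k |d_k|^2 and the quadratic part of g costs |A_k d_k|^2 / 2, at
    most half of that. *)
Lemma pass_descent (xn xo : blocks R N K) :
  feasible X xo -> pass_vi xn xo ->
  2^-1 * \sum_k P k * dotv (xn k - xo k) (xn k - xo k)
    <= objective A b h xo - objective A b h xn.
Proof.
move=> Xxo vi; rewrite /objective opprD addrACA -sumrB.
rewrite -[X in _ <= X + _]opprB !smooth_partE (residualB xn xo).
rewrite half_sqr_telescope addrC -sumrB mulr_sumr; apply: ler_sum => k _.
rewrite -residual_partial_update.
have := vi k _ (Xxo k); have := block_form_le k (xn k - xo k).
have -> : xo k - xn k = - (xn k - xo k) by rewrite opprB.
rewrite mulmxN !dotvNr; move: (dotv _ _) (dotv _ _) (dotv _ _) => a c d.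
by lra.
Qed.

(** Convexity of g yields the residual at xn, whereas step k sees the partially updated one. They
    differ by the sum of A_j d_j over j >= k: the terms j > k form the triangular sum, and j = k
    joins the proximal term. *)
Lemma pass_cost (xn xo xs : blocks R N K) :
  feasible X xs -> pass_vi xn xo ->
  objective A b h xn - objective A b h xs <=
    \sum_(j < K) \sum_(k < K | (k < j)%N)
      dotv (A j *m (xn j - xo j)) (A k *m (xn k - xs k))
    - \sum_(k < K) (P k * dotv (xn k - xo k) (xn k - xs k)
        - dotv (A k *m (xn k - xo k)) (A k *m (xn k - xs k))).
Proof.
move=> Xxs vi; rewrite /objective opprD addrACA -sumrB.
set q := fun k => A k *m (xn k - xs k).
set u := fun k => A k *m (xn k - xo k).
have smooth_le : smooth_part A b xn - smooth_part A b xs <=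
    \sum_k dotv (residual A b xn) (q k).
  rewrite -dotv_sumr !smooth_partE.
  have -> : residual A b xs = residual A b xn - \sum_k q k.
    by rewrite (residualB xn xs) addrK.
  have := dotv_ge0 (\sum_k q k); move: (residual _ _ _) (\sum_k q k) => rho s.
  rewrite !(dotvDl, dotvDr, dotvNl, dotvNr) (dotvC s rho); lra.
have h_le : \sum_k (h k (xn k) - h k (xs k)) <= \sum_k
    (- dotv (residual A b (partial_update xn xo k)) (q k)
     - P k * dotv (xn k - xo k) (xn k - xs k)).
  apply: ler_sum => k _; apply: le_trans (vi k _ (Xxs k)) _.
  have -> : xs k - xn k = - (xn k - xs k) by rewrite opprB.
  by rewrite mulmxN !dotvNr mulrN.
apply: le_trans (lerD smooth_le h_le) _; rewrite -big_split /=.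
rewrite (exchange_big_dep xpredT) //= -sumrB.
rewrite le_eqVlt; apply/orP; left; apply/eqP; apply: eq_bigr => k _.
rewrite residual_partial_update (residualB xn xo) -/(u _).
rewrite (bigID (fun j : 'I_K => (k <= j)%N)) /= (bigD1 k) //=.
have -> : \sum_(j < K | ~~ (k <= j)%N) A j *m (xn j - xo j) =
    \sum_(j < K | (j < k)%N) A j *m (xn j - xo j).
  by apply: eq_bigl => j; rewrite ltnNge.
have -> : \sum_(j < K | (k <= j)%N && (j != k)) A j *m (xn j - xo j) =
    \sum_(j < K | (k < j)%N) A j *m (xn j - xo j).
  by apply: eq_bigl => j; rewrite ltn_neqAle -val_eqE eq_sym andbC.
rewrite -dotv_suml.
rewrite !(dotvDl _ _ (q k)) -/(u k) -/(q k); lra.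
Qed.

End CyclicPass.

(** * The triangular bound for the blocks of A *)

Lemma big_nat_ord (V : nmodType) a b n (F : nat -> V) : (b <= n)%N ->
  \sum_(a <= k < b) F k = \sum_(k < n | (a <= k < b)%N) F k.
Proof.
move=> bn; rewrite (big_nat_widen a b n) // (big_nat_widenl a 0) // big_mkord.
by apply: eq_bigl => k; rewrite andbC.
Qed.

(** Apply [triangular_truncation] to t d and e, then divide by t to get the Young weights t and
    1/t. *)
Lemma block_triangular (R : realType) M N K (A : 'I_K -> 'M[R]_(M, N))
    (d e : blocks R N K) (t : R) m :
  (0 < N)%N -> 0 < t -> (K <= 2 ^ m)%N ->
  4 * \sum_(j < K) \sum_(k < K | (k < j)%N) dotv (A j *m d j) (A k *m e k)
    <= m%:R * Lip A * (\sum_k dotv (d k) (d k) * t + \sum_k dotv (e k) (e k) / t).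
Proof.
case: K A d e => [|K] A d e N_gt0 t_gt0 Km.
  by rewrite !big_ord0 mulr0 addr0 mulr0.
pose D j := t *: (A (inord j) *m d (inord j)).
pose E j := A (inord j) *m e (inord j).
pose dd j := t ^+ 2 * dotv (d (inord j)) (d (inord j)).
pose ee j := dotv (e (inord j)) (e (inord j)).
have DE_le a p b : (a <= p)%N -> (p <= b)%N -> (b <= K.+1)%N ->
     let s := \sum_(a <= k < p) E k + \sum_(p <= k < b) D k in
     dotv s s <= Lip A * (\sum_(a <= k < p) ee k + \sum_(p <= k < b) dd k).
  move=> ap pb bK /=.
  (* Gluing e on the left interval to t d on the right one turns the corner hypothesis into
     [Lip_form_le]. *)
  pose v : blocks R N K.+1 := fun i =>
    if (a <= i < p)%N then e i else if (p <= i < b)%N then t *: d i else 0.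
  have disj (i : 'I_K.+1) : (a <= i < p)%N -> (p <= i < b)%N = false.
    by move=> /andP[_ ip]; rewrite leqNgt ip.
  have -> : \sum_(a <= k < p) E k + \sum_(p <= k < b) D k = \sum_i A i *m v i.
    rewrite !(@big_nat_ord _ _ _ K.+1) ?(leq_trans pb) //.
    rewrite big_mkcond [X in _ + X]big_mkcond -big_split; apply: eq_bigr => i _ /=.
    rewrite /v /E /D inord_val; case: ifP => [/disj -> /=|_]; first by rewrite addr0.
    by case: ifP => _; rewrite add0r ?scalemxAr ?mulmx0.
  have -> : \sum_(a <= k < p) ee k + \sum_(p <= k < b) dd k =
      \sum_i dotv (v i) (v i).
    rewrite !(@big_nat_ord _ _ _ K.+1) ?(leq_trans pb) //.
    rewrite big_mkcond [X in _ + X]big_mkcond -big_split; apply: eq_bigr => i _ /=.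
    rewrite /v /ee /dd inord_val; case: ifP => [/disj -> /=|_]; first by rewrite addr0.
    by case: ifP => _; rewrite add0r ?dotvZl ?dotvZr ?dotv0r // mulrA -expr2.
  exact: Lip_form_le.
have L_ge0 : 0 <= Lip A.
  by apply: gram_lambda_max_ge0; rewrite sum_nat_const card_ord muln_gt0 N_gt0.
have dd_ge0 k : 0 <= dd k by rewrite mulr_ge0 ?sqr_ge0 ?dotv_ge0.
have ee_ge0 k : 0 <= ee k by exact: dotv_ge0.
have := triangular_truncation L_ge0 dd_ge0 ee_ge0 DE_le (leq0n _) (leqnn _) Km.
rewrite !big_mkord.
have -> : \sum_(j < K.+1) \sum_(0 <= k < j) dotv (D j) (E k) =
    t * \sum_(j < K.+1) \sum_(k < K.+1 | (k < j)%N)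
      dotv (A j *m d j) (A k *m e k).
  rewrite mulr_sumr; apply: eq_bigr => j _.
  rewrite (@big_nat_ord _ _ _ K.+1) ?(ltnW (ltn_ord j)) // mulr_sumr /=.
  by apply: eq_bigr => k _; rewrite /D /E !inord_val dotvZl.
have -> : \sum_(k < K.+1) (dd k + ee k) =
    t * (\sum_k dotv (d k) (d k) * t + \sum_k dotv (e k) (e k) / t).
  rewrite big_split /= mulrDr !mulr_sumr; congr (_ + _); apply: eq_bigr => k _.
    by rewrite /dd inord_val; ring.
  by rewrite /ee inord_val; field; rewrite gt_eqF.
by rewrite mulrCA [leRHS]mulrCA ler_pM2l.
Qed.

(** * The rate for inverse stepsizes between [pmin] and [pmax], covering both stepsize rules *)

Section Rate.
Context (R : realType) (M N K : nat).
Context (A : 'I_K -> 'M[R]_(M, N)) (b : 'cV[R]_M).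
Context (X : 'I_K -> set 'cV[R]_N) (h : 'I_K -> 'cV[R]_N -> R) (P : 'I_K -> R).
Context (pmin pmax : R).
Hypothesis N_gt0 : (0 < N)%N.
Hypothesis K_gt0 : (0 < K)%N.
Hypothesis P_ge : forall k, Lblk A k <= P k.
Hypothesis pmin_gt0 : 0 < pmin.
Hypothesis P_bounds : forall k, pmin <= P k <= pmax.
Hypothesis pmax_le : pmax <= Lip A.

Lemma pass_young (xn xo xs : blocks R N K) (m : nat) t :
  (K <= 2 ^ m)%N -> 0 < t -> feasible X xs -> pass_vi A b X h P xn xo ->
  2 * (objective A b h xn - objective A b h xs) <=
    (m%:R / 2 + 1) * (\sum_k P k * dotv (xn k - xo k) (xn k - xo k)) * t
    + (m%:R / 2 * (Lip A ^+ 2 / pmin) + pmax) * bdist xn xs ^+ 2 / t.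
Proof.
move=> Km t_gt0 Xxs vi; have := pass_cost Xxs vi.
set d := fun k => xn k - xo k; set e := fun k => xn k - xs k.
rewrite bdist_sqr -/d -/e.
set T := \sum_j \sum_(k | _) _; set S := \sum_k P k * _.
set E := \sum_k dotv (e k) (e k); set B := \sum_k (_ - _) => cost.

have L_gt0 : 0 < Lip A.
  have /andP[lo hi] := P_bounds (Ordinal K_gt0).
  exact: lt_le_trans pmin_gt0 (le_trans lo (le_trans hi pmax_le)).
have c_ge0 : 0 <= m%:R / 2 :> R by rewrite divr_ge0.
have T_le : 2 * T <= m%:R / 2 * S * t + m%:R / 2 * (Lip A ^+ 2 / pmin) * E / t.
  (* This Young parameter turns Lip |d|^2 into t pmin |d|^2, at most t S, and leaves Lip^2 / pmin on
     the e side. *)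
  have s_gt0 : 0 < t * pmin / Lip A by rewrite divr_gt0 ?mulr_gt0.
  have := @block_triangular _ _ _ _ A d e _ m N_gt0 s_gt0 Km.
  rewrite -/T -!mulr_suml -/E => T_le.
  have dS : pmin * \sum_k dotv (d k) (d k) <= S.
    rewrite mulr_sumr; apply: ler_sum => k _.
    by rewrite ler_wpM2r ?dotv_ge0 //; have /andP[] := P_bounds k.
  have : m%:R / 2 * t * (pmin * \sum_k dotv (d k) (d k)) <= m%:R / 2 * t * S.
    by rewrite ler_wpM2l // mulr_ge0 // ltW.
  move: T_le; set Dn := \sum_k dotv (d k) (d k).
  have -> : m%:R * Lip A * (Dn * (t * pmin / Lip A) + E / (t * pmin / Lip A)) =
    2 * (m%:R / 2 * t * (pmin * Dn)) + 2 * (m%:R / 2 * (Lip A ^+ 2 / pmin) * E / t).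
    by field; rewrite !gt_eqF.
  lra.
(* Expand the positive semidefinite form P_k I - A_k^T A_k at t v + w. *)
have form_le k v w : - 2 * (P k * dotv v w - dotv (A k *m v) (A k *m w))
    <= P k * dotv v v * t + pmax * dotv w w / t.
  rewrite -(ler_pM2r t_gt0) mulrDl divfK ?gt_eqF //.
  have := block_form_le N_gt0 P_ge k (t *: v + w).
  have wP : P k * dotv w w <= pmax * dotv w w.
    by rewrite ler_wpM2r ?dotv_ge0 //; have /andP[] := P_bounds k.
  have := mulr_ge0 (sqr_ge0 t) (dotv_ge0 (A k *m v)).
  have := dotv_ge0 (A k *m w).
  rewrite mulmxDr -scalemxAr !(dotvDl, dotvDr, dotvZl, dotvZr).
  rewrite (dotvC w v) (dotvC (A k *m w)); lra.
have B_le : - 2 * B <= S * t + pmax * E / t.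
  have -> : pmax * E / t = \sum_k pmax * dotv (e k) (e k) / t.
    by rewrite -mulr_suml -mulr_sumr.
  rewrite mulr_suml -big_split mulr_sumr; apply: ler_sum => k _ /=.
  exact: form_le.
lra.
Qed.

Lemma cyclic_bcpg_rate (x : nat -> blocks R N K) :
  (forall k, convex_set (X k)) -> (forall k, convex_function (X k) (h k)) ->
  optimal_set A b X h !=set0 ->
  has_ubound (level_distances A b X h (x 0%N)) ->
  cyclic_bcpg A b X h P x ->
  let Delta r := objective A b h (x r) - optimal_value A b X h in
  forall r, Delta r.+1 <= 3 * Num.max (Delta 0%N)
    (2 * ln (2 * N * K)%N%:R ^+ 2 * (pmax + Lip A ^+ 2 / pmin)
     * R0 A b X h (x 0%N) ^+ 2) / r.+1%:R.
Proof.
move=> X_convex h_convex [xs xs_opt] R0_finite x_bcpg Delta r.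
have [Xxs xs_min] := xs_opt.
have opt_valE : optimal_value A b X h = objective A b h xs.
  apply/eqP; rewrite eq_le; apply/andP; split.
    apply: ge_inf; last by exists xs.
    by exists (objective A b h xs) => _ [y Xy <-]; exact: xs_min.
  apply: lb_le_inf; first by exists (objective A b h xs), xs.
  by move=> _ [y Xy <-]; exact: xs_min.
have P_ge0 k : 0 <= P k.
  by have /andP[lo _] := P_bounds k; exact: ltW (lt_le_trans pmin_gt0 lo).
have Xx s : feasible X (x s).
  by case: s => [|s] k; [exact: x_bcpg.1|case: (x_bcpg.2 s k)].
have vi s : pass_vi A b X h P (x s.+1) (x s).
  exact: cyclic_bcpg_pass_vi x_bcpg.
have descent s := pass_descent N_gt0 P_ge (Xx s) (vi s).
have S_ge0 s : 0 <= \sum_k P k * dotv (x s.+1 k - x s k) (x s.+1 k - x s k).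
  by apply: sumr_ge0 => k _; rewrite mulr_ge0 ?dotv_ge0.
have Delta_ge0 s : 0 <= Delta s by rewrite subr_ge0 opt_valE; exact: xs_min.
have Delta_noninc s : Delta s.+1 <= Delta s.
  by rewrite lerD2r; have := descent s; have := S_ge0 s; lra.
have obj_le s : objective A b h (x s) <= objective A b h (x 0%N).
  elim: s => // s; apply: le_trans.
  by have := Delta_noninc s; rewrite lerD2r.
set rad := R0 _ _ _ _ _.
(* By descent all iterates stay in the level set of [x 0]. *)
have dist_le s : bdist (x s) xs <= rad.
  by apply: ub_le_sup => //; exists (x s), xs; split.
have rad2 s : bdist (x s) xs ^+ 2 <= rad ^+ 2.
  by rewrite lerXn2r ?nnegrE ?(le_trans _ (dist_le s)) ?enorm_ge0.
have NK_gt0 : (0 < N * K)%N by rewrite muln_gt0 N_gt0.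
have [m NKm mC] := ln_double_lower R NK_gt0.
have Km : (K <= 2 ^ m)%N by apply: leq_trans NKm; rewrite leq_pmull.
have [pmin_pmax pmax_gt0] : pmin <= pmax /\ 0 < pmax.
  have /andP[lo hi] := P_bounds (Ordinal K_gt0).
  by have := pmin_gt0; split; lra.
set p := Lip A ^+ 2 / pmin.
have pmax_p : pmax <= p.
  rewrite ler_pdivlMr // expr2 ler_pM // ?(ltW pmax_gt0) ?(ltW pmin_gt0) //.
  exact: le_trans pmin_pmax pmax_le.
have p_ge0 : 0 <= p by lra.
have := mC _ _ (ltW pmax_gt0) pmax_p; rewrite mulnA => {}mC.
set l2 := ln _ ^+ 2 in mC *.
pose C := 2 * l2 * (pmax + p) * rad ^+ 2.
(* [quadratic_descent_rate] doubles [B], whence the factor 3 of the theorem. *)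
pose B := 3 / 2 * Num.max (Delta 0%N) C.
have c_ge0 : 0 <= m%:R / 2 :> R by rewrite divr_ge0.
have q_ge0 : 0 <= m%:R / 2 * p + pmax.
  by apply: addr_ge0 (ltW pmax_gt0); exact: mulr_ge0.
have Delta0B : Delta 0%N <= B.
  have : Delta 0%N <= Num.max (Delta 0%N) C by rewrite le_max lexx.
  by have := Delta_ge0 0%N; rewrite /B; lra.
have CB : 3 / 2 * C <= B by rewrite ler_pM2l ?le_max ?lexx ?orbT //; lra.
have Delta_sqr s : Delta s.+1 ^+ 2 <= B * (Delta s - Delta s.+1).
  set S := \sum_k P k * dotv (x s.+1 k - x s k) (x s.+1 k - x s k).
  have sqr_le : Delta s.+1 ^+ 2 <=
      (m%:R / 2 + 1) * S * ((m%:R / 2 * p + pmax) * rad ^+ 2).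
    apply: sqr_le_of_young => //.
    - by rewrite mulr_ge0 ?S_ge0 ?addr_ge0.
    - by rewrite mulr_ge0 ?sqr_ge0.
    move=> t t_gt0; rewrite /Delta opt_valE.
    apply: le_trans (pass_young Km t_gt0 Xxs (vi s)) _.
    rewrite lerD2l ler_wpM2r ?invr_ge0 ?(ltW t_gt0) //.
    by rewrite ler_wpM2l.
  apply: le_trans sqr_le _.
  have S_le : S <= 2 * (Delta s - Delta s.+1).
    by have := descent s; rewrite -/S /Delta; lra.
  have dD_ge0 : 0 <= Delta s - Delta s.+1 by rewrite subr_ge0.
  apply: le_trans (ler_wpM2r dD_ge0 CB).
  set G := (m%:R / 2 * p + pmax) * rad ^+ 2.
  have G_ge0 : 0 <= G by rewrite mulr_ge0 ?sqr_ge0.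
  apply: (@le_trans _ _ ((m%:R / 2 + 1) * (2 * (Delta s - Delta s.+1)) * G)).
    by rewrite ler_wpM2r // ler_wpM2l // addr_ge0.
  have -> : (m%:R / 2 + 1) * (2 * (Delta s - Delta s.+1)) * G =
      (2 * (m%:R / 2 + 1) * (m%:R / 2 * p + pmax))
      * (rad ^+ 2 * (Delta s - Delta s.+1)) by rewrite /G; ring.
  have -> : 3 / 2 * C * (Delta s - Delta s.+1) =
      3 * l2 * (p + pmax) * (rad ^+ 2 * (Delta s - Delta s.+1)).
    by rewrite /C; field.
  by rewrite ler_wpM2r // mulr_ge0 ?sqr_ge0.
(* At index r + 1 the bound has denominator r + 2, which is weakened to r + 1. *)
have := quadratic_descent_rate Delta_ge0 Delta0B Delta_sqr r.+1.
move=> /le_trans; apply.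
have -> : 2 * B = 3 * Num.max (Delta 0%N) C by rewrite /B; field.
rewrite ler_wpM2l ?lef_pV2 ?posrE ?ltr0n ?ler_nat //.
by rewrite mulr_ge0 // le_max Delta_ge0.
Qed.

End Rate.

(** * Extremal block constants and the two stepsize rules *)

Section BlockConstants.
Context (R : realType) (M N K : nat) (A : 'I_K -> 'M[R]_(M, N)).
Hypothesis N_gt0 : (0 < N)%N.
Hypothesis K_gt0 : (0 < K)%N.

Lemma Lblk_le_Lmax k : Lblk A k <= Lmax A.
Proof.
apply: ub_le_sup; last by exists k.
by exists (Lip A) => _ [j _ <-]; exact: Lblk_le_Lip.
Qed.

Lemma Lmax_le_Lip : Lmax A <= Lip A.
Proof.
apply: ge_sup => [|_ [j _ <-]]; last exact: Lblk_le_Lip.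
by exists (Lblk A (Ordinal K_gt0)), (Ordinal K_gt0).
Qed.

Lemma Lmin_le_Lblk k : Lmin A <= Lblk A k.
Proof.
apply: ge_inf; last by exists k.
by exists 0 => _ [j _ <-]; exact: gram_lambda_max_ge0.
Qed.

(** The infimum over finitely many blocks is attained, so positivity survives. *)
Lemma Lmin_gt0 : (forall k, 0 < Lblk A k) -> 0 < Lmin A.
Proof.
move=> L_gt0; pose k0 := Ordinal K_gt0.
case: (@arg_minP _ _ _ k0 xpredT (Lblk A) isT) => i _ i_min.
apply: lt_le_trans (L_gt0 i) _; apply: lb_le_inf.
  by exists (Lblk A k0), k0.
by move=> _ [j _ <-]; exact: i_min.
Qed.

End BlockConstants.

(* Comparing xs with its reflection 2 xs - x bounds the first-order term of the
   expansion of the objective at xs by the second-order one. *)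
Lemma smooth_gap_le (R : realType) M N K (A : 'I_K -> 'M[R]_(M, N)) b
    (x xs : blocks R N K) : (0 < N)%N -> (0 < K)%N ->
  (forall y, smooth_part A b xs <= smooth_part A b y) ->
  smooth_part A b x - smooth_part A b xs <= Lip A * bdist x xs ^+ 2.
Proof.
move=> N_gt0 K_gt0 xs_min; rewrite bdist_sqr.
apply: le_trans (Lip_form_le _ _ N_gt0 K_gt0).
pose y : blocks R N K := fun k => xs k - (x k - xs k).
have := xs_min y; rewrite !smooth_partE (residualB A b x xs) (residualB A b y xs).
have -> : \sum_k A k *m (y k - xs k) = - \sum_k A k *m (x k - xs k).
  by rewrite -sumrN; apply: eq_bigr => k _; rewrite /y addrAC subrr sub0r mulmxN.
move: (residual _ _ _) (\sum_k _) => rho s.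
rewrite !(dotvDl, dotvDr, dotvNl, dotvNr) (dotvC s rho); lra.
Qed.

Theorem theorem2p1 (R : realType) (M N K : nat)
    (N_gt0 : (0 < N)%N) (K_gt0 : (0 < K)%N)
    (A : 'I_K -> 'M[R]_(M, N)) (b : 'cV[R]_M)
    (X : 'I_K -> set 'cV[R]_N) (h : 'I_K -> 'cV[R]_N -> R)
    (P : 'I_K -> R) (x : nat -> blocks R N K)
    (X_neq0 : forall k, X k !=set0)
    (X_closed : forall k, closed (X k))
    (X_convex : forall k, convex_set (X k))
    (h_convex : forall k, convex_function (X k) (h k))
    (h_lsc : forall k, lsc_on (X k) (h k))
    (P_gt0 : forall k, 0 < P k)
    (P_ge : forall k, Lblk A k <= P k)
    (opt_neq0 : optimal_set A b X h !=set0)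
    (R0_finite : has_ubound (level_distances A b X h (x 0%N)))
    (x_bcpg : cyclic_bcpg A b X h P x) :
  let Delta r := objective A b h (x r) - optimal_value A b X h in
  let rad := R0 A b X h (x 0%N) in
  let log2NK := ln ((2 * N * K)%N%:R : R) in
  forall r : nat,
    ((forall k, P k = Lip A) ->
       Delta r.+1 <= 3 * Num.max (Delta 0%N)
                           (4 * log2NK ^+ 2 * Lip A * rad ^+ 2) / r.+1%:R)
    /\
    ((forall k, P k = Lblk A k) ->
       Delta r.+1 <= 3 * Num.max (Delta 0%N)
                           (2 * log2NK ^+ 2
                            * (Lmax A + Lip A ^+ 2 / Lmin A) * rad ^+ 2)
                       / r.+1%:R
       /\
       ((forall k, X k = [set: 'cV[R]_N] /\ forall y, h k y = 0) ->
          Delta r.+1 <= 3 * Num.max (Lip A)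
                              (2 * log2NK ^+ 2
                               * (Lmax A + Lip A ^+ 2 / Lmin A))
                          * (rad ^+ 2 / r.+1%:R))).
Proof.
move=> Delta rad log2NK r; split=> [P_Lip|P_Lblk].
  have L_gt0 : 0 < Lip A by rewrite -(P_Lip (Ordinal K_gt0)).
  have P_bounds k : Lip A <= P k <= Lip A by rewrite P_Lip lexx.
  have := cyclic_bcpg_rate N_gt0 K_gt0 P_ge L_gt0 P_bounds (lexx _)
    X_convex h_convex opt_neq0 R0_finite x_bcpg r.
  (* With pmin = pmax = L the two terms coincide, and the constant 2 becomes 4. *)
  have -> : Lip A + Lip A ^+ 2 / Lip A = 2 * Lip A.
    by field; rewrite gt_eqF.
  by suff -> : 4 * log2NK ^+ 2 * Lip A = 2 * log2NK ^+ 2 * (2 * Lip A) by []; ring.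
have L_gt0 k : 0 < Lblk A k by rewrite -P_Lblk.
have Lmin0 : 0 < Lmin A by exact: Lmin_gt0.
have P_bounds k : Lmin A <= P k <= Lmax A.
  by rewrite P_Lblk Lmin_le_Lblk //= Lblk_le_Lmax.
have rate := cyclic_bcpg_rate N_gt0 K_gt0 P_ge Lmin0 P_bounds
  (Lmax_le_Lip _ N_gt0 K_gt0) X_convex h_convex opt_neq0 R0_finite x_bcpg r.
split=> // smooth; apply: le_trans rate _.
have [xs xs_opt] := opt_neq0; have [_ xs_min] := xs_opt.
have objE y : objective A b h y = smooth_part A b y.
  by rewrite /objective big1 ?addr0 // => k _; have [_ ->] := smooth k.
have feas y : feasible X y by move=> k; have [-> _] := smooth k.
have dist_le : bdist (x 0%N) xs <= rad.
  by apply: ub_le_sup => //; exists (x 0%N), xs; split.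
have rad_le : bdist (x 0%N) xs ^+ 2 <= rad ^+ 2.
  by rewrite lerXn2r ?nnegrE ?(le_trans _ dist_le) ?enorm_ge0.
have Lip_ge0 : 0 <= Lip A.
  apply: le_trans (Lblk_le_Lip A (Ordinal K_gt0) N_gt0 K_gt0).
  exact: ltW (L_gt0 _).
(* The initial gap is itself at most L R0^2, so R0^2 factors out of the maximum. *)
have Delta0 : Delta 0%N <= Lip A * rad ^+ 2.
  apply: (@le_trans _ _ (smooth_part A b (x 0%N) - smooth_part A b xs)).
    rewrite /Delta objE lerD2l lerN2; apply: lb_le_inf.
      by exists (objective A b h xs), xs.
    by move=> _ [y _ <-]; rewrite -objE; exact: xs_min.
  apply: le_trans (ler_wpM2l Lip_ge0 rad_le).
  by apply: smooth_gap_le => // y; rewrite -!objE; exact: xs_min.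
rewrite [leRHS]mulrA -(mulrA 3 _ (rad ^+ 2)).
rewrite ler_pM2r ?invr_gt0 ?ltr0n // ler_pM2l // maxr_pMl ?sqr_ge0 //.
by rewrite ge_max !le_max Delta0 lexx orbT.
Qed.
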